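(* For any function $s(n) = O(n^{1/2-\epsilon})$, where $\epsilon>0$ is a constant, there is a family of directed acyclic graphs $\{G_n\}_{n=1}^{\infty}$, where $G_n$ has $\Theta(n)$ vertices, a single sink, and fan-in at most $2$, such that the standard pebbling price of $G_n$ is $O(s(n))$ and the reversible pebbling price of $G_n$ is $\Omega(s(n)\log n)$ (where the constant hidden in the $\Omega$ depends linearly on $\epsilon$).
   Context: All graphs are finite directed acyclic graphs (DAGs); $\mathrm{pred}(v)$ denotes the set of immediate predecessors of $v$, and fan-in at most $2$ means $|\mathrm{pred}(v)|\le 2$ for all $v$. A pebble configuration is a subset of vertices. A standard pebbling is a sequence of configurations $P_0,\dots,P_\tau$ in which each configuration arises from the previous one either by placing a pebble on a vertex $v\notin P$ with $\mathrm{pred}(v)\subseteq P$, or by removing a pebble from any $v\in P$. A reversible pebbling is defined the same way except that a pebble may be removed from $v\in P$ only if $\mathrm{pred}(v)\subseteq P$. The space of a pebbling is $\max_t |P_t|$. For a DAG with unique sink $z$, the standard (resp. reversible) pebbling price is the minimum space of a standard (resp. reversible) pebbling with $P_0=\emptyset$ and $P_\tau=\{z\}$.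
   Formalization: The formal theorem additionally assumes that s(n) is eventually bounded below by some constant d > 0; without this the claim fails (e.g. s(n) = 1/n, since every pebbling price is at least 1). The constant in O(s(n)) depends only on d. *)

(* Defs.v *)
From mathcomp Require Import all_boot.
From mathcomp Require Import boolp.

Set Implicit Arguments.
Unset Strict Implicit.
Unset Printing Implicit Defensive.

Record dag := Dag {
  vertex :> finType;
  edge : rel vertex;
  edge_acyclic : forall u v : vertex, edge u v -> ~~ connect edge v u }.

Definition preds (G : dag) (v : G) : {set G} := [set u | edge u v].

Definition is_sink (G : dag) (v : G) : Prop := forall w : G, ~~ edge v w.

Definition unique_sink (G : dag) (z : G) : Prop :=
  forall v : G, is_sink v <-> v = z.

Definition fan_in_le (G : dag) (k : nat) : Prop :=
  forall v : G, #|preds v| <= k.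

Definition placement (G : dag) (P Q : {set G}) : bool :=
  [exists v, [&& v \notin P, preds v \subset P & Q == v |: P]].

Definition std_removal (G : dag) (P Q : {set G}) : bool :=
  [exists v, (v \in P) && (Q == P :\ v)].

Definition rev_removal (G : dag) (P Q : {set G}) : bool :=
  [exists v, [&& v \in P, preds v \subset P & Q == P :\ v]].

Definition std_step (G : dag) : rel {set G} :=
  fun P Q => placement P Q || std_removal P Q.

Definition rev_step (G : dag) : rel {set G} :=
  fun P Q => placement P Q || rev_removal P Q.

(* A pebbling P_0, ..., P_tau with P_0 empty is represented by the sequence
   P_1, ..., P_tau. *)
Definition pebbling (G : dag) (step : rel {set G}) (z : G)
    (Ps : seq {set G}) : Prop :=
  path step set0 Ps /\ last set0 Ps = [set z].

Definition space (G : dag) (Ps : seq {set G}) : nat :=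
  \max_(P <- set0 :: Ps) #|P|.

Definition pebbling_space (G : dag) (step : rel {set G}) (z : G)
    (k : nat) : Prop :=
  exists2 Ps, pebbling step z Ps & space Ps = k.

Lemma rev_step_sym (G : dag) : symmetric (@rev_step G).
Proof.
suff h : forall P Q, @rev_step G P Q -> rev_step Q P.
  by move=> P Q; apply/idP/idP; apply: h.
have npred (v : G) : v \notin preds v.
  rewrite inE; apply/negP => e; have := edge_acyclic e.
  by rewrite connect0.
move=> P Q /orP[] /existsP[v /and3P[vP pP /eqP ->]]; apply/orP; [right|left];
    apply/existsP; exists v.
  rewrite setU11 setU1K // eqxx andbT /=.
  exact: subset_trans pP (subsetUr _ _).
by rewrite setD11 setD1K // eqxx andbT /= subsetD1 pP npred.
Qed.

Lemma connect_downset (G : dag) (A B : {set G}) :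
  (forall v, v \in A -> preds v \subset A) -> connect (@rev_step G) B (B :|: A).
Proof.
have [m] := ubnP #|A|; elim: m A => // m IHm A; rewrite ltnS => leAm dA.
have [->|[x xA]] := set_0Vmem A; first by rewrite setU0 connect0.
case: (@arg_minnP _ x (mem A) (fun v => #|connect (@edge G) v|) xA) => v /= vA vmin.
have {}vA : v \in A by [].
have maxv u : u \in A -> ~~ edge v u.
  move=> uA; apply/negP => evu.
  have: #|connect (@edge G) u| < #|connect (@edge G) v|.
    apply: proper_card; apply/properP; split.
      apply/subsetP => w cuw; apply: connect_trans (connect1 evu) _; exact: cuw.
    by exists v; [exact: connect0 | exact: edge_acyclic evu].
  by rewrite ltnNge vmin.
have dA' u : u \in A :\ v -> preds u \subset A :\ v.
  case/setD1P => _ uA; rewrite subsetD1 dA //= inE; exact: maxv.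
have c : connect (@rev_step G) B (B :|: (A :\ v)).
  by apply: IHm dA'; rewrite [X in X <= _](cardsD1 v) vA in leAm.
apply: connect_trans c _.
have eqA : B :|: A = v |: (B :|: (A :\ v)) by rewrite setUCA setD1K.
have [vB|vB] := boolP (v \in B :|: A :\ v).
  by rewrite eqA; move: vB; rewrite -sub1set => /setUidPr ->; apply: connect0.
apply: connect1; apply/orP; left; apply/existsP; exists v.
rewrite vB eqA eqxx andbT /=.
apply: subset_trans (subsetUr _ _); rewrite subsetD1 dA //= inE.
exact: maxv.
Qed.

Lemma rev_pebbling_exists (G : dag) (z : G) :
  exists k, `[< pebbling_space (@rev_step G) z k >].
Proof.
have cT B : connect (@rev_step G) B setT.
  by rewrite -[X in connect _ _ X](setUT B); apply: connect_downset.
have cs := sym_connect_sym (@rev_step_sym G).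
have: connect (@rev_step G) set0 [set z].
  by apply: connect_trans (cT _) _; rewrite cs.
case/connectP => Ps h l; exists (space Ps); apply/asboolP.
by exists Ps.
Qed.

Lemma std_pebbling_exists (G : dag) (z : G) :
  exists k, `[< pebbling_space (@std_step G) z k >].
Proof.
have [k /asboolP[Ps [h l] _]] := rev_pebbling_exists z.
exists (space Ps); apply/asboolP; exists Ps => //; split => //.
apply: sub_path h => P Q /orP[pl|/existsP[v /and3P[vP _ e]]]; apply/orP.
  by left.
by right; apply/existsP; exists v; rewrite vP.
Qed.

Definition std_price (G : dag) (z : G) : nat := ex_minn (std_pebbling_exists z).

Definition rev_price (G : dag) (z : G) : nat := ex_minn (rev_pebbling_exists z).

(* Main.v *)
Require Import Defs.
From mathcomp Require Import all_boot zify.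
From mathcomp Require Import boolp.

(** [G_n] is the path [0 -> 1 -> ... -> n] with additional edges [u -> u + w],
    where [w] is about [s n]. Sliding a window of [w] consecutive pebbles along
    the path gives standard price at most [w + 1].

    For the reversible lower bound, call [u] linked to [a] when a pebble-free
    path leads to [u] from one of the [w] vertices starting at [a]. Since moves
    are reversible, a pebble-free path stays free, forwards and backwards in
    time, for as long as its first vertex does. A region with fewer than [w]
    pebbles contains a free residue class modulo [w] and a free block of length
    [2 w], so nearly every path through it can be linked to its bottom. Hence,
    by induction on [k], to pebble a vertex linked to a point [O(2^k w^2)] below
    it, one needs [(k + 1) w] pebbles: once the vertex has become unlinked from
    the middle for good, neither half can drop below [w] pebbles, while by
    induction the upper half must at some time hold [k w]. As [n / w^2] is at
    least of order [n^(2 eps)], one may take [k] of order [eps * ln n]. *)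

Set Implicit Arguments.
Unset Strict Implicit.
Unset Printing Implicit Defensive.

(** * The graph: a path with chords of length [w] *)

Section Helix.
Variables N w0 : nat.
Local Notation w := w0.+1.

Definition helix_edge : rel 'I_N.+1 :=
  fun u v => (v == u.+1 :> nat) || (v == u + w :> nat).

Lemma helix_edge_lt u v : helix_edge u v -> u < v <= u + w.
Proof. by rewrite /helix_edge => /orP[] /eqP ->; lia. Qed.

Lemma helix_acyclic u v : helix_edge u v -> ~~ connect helix_edge v u.
Proof.
move=> /helix_edge_lt uv; apply/negP => /connectP[p vp lp].
suff: v <= last v p by rewrite -lp; lia.
elim: p v {uv lp} vp => //= y p IHp v /andP[/helix_edge_lt vy /IHp]; lia.
Qed.

Definition helix := Dag helix_acyclic.

Implicit Types (u v x y : helix) (P Q : {set helix}).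

Lemma helix_edgeE u v :
  edge u v = (v == u.+1 :> nat) || (v == u + w :> nat).
Proof. by []. Qed.

Lemma helix_sink : unique_sink (ord_max : helix).
Proof.
move=> v; split=> [sv|-> u]; last first.
  by rewrite helix_edgeE; have := ltn_ord u; rewrite /=; lia.
apply: val_inj => /=; have := ltn_ord v.
have [vN|] := ltnP v N; last by move=> *; lia.
by have := sv (inord v.+1); rewrite helix_edgeE inordK ?eqxx.
Qed.

Lemma helix_fan_in : fan_in_le helix 2.
Proof.
move=> v; apply: (@leq_trans #|[set inord v.-1; inord (v - w)] : {set helix}|).
  apply/subset_leq_card/subsetP => u; rewrite !inE helix_edgeE.
  by case/orP=> /eqP ->; rewrite ?addnK /= inord_val eqxx ?orbT.
by rewrite cards2; case: (_ != _).
Qed.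

(** * Standard pebbling by a sliding window *)

Definition std_reach k P Q :=
  exists2 Ps, path (@std_step helix) P Ps && (last P Ps == Q)
            & all (fun P' => #|P'| <= k) Ps.

Lemma std_reach_refl k P : std_reach k P P.
Proof. by exists [::] => //=. Qed.

Lemma std_reach_trans k P Q P' :
  std_reach k P Q -> std_reach k Q P' -> std_reach k P P'.
Proof.
move=> [Ps /andP[pP /eqP lP] aP] [Qs pQ aQ]; exists (Ps ++ Qs).
  by rewrite cat_path last_cat lP pP.
by rewrite all_cat aP.
Qed.

Lemma std_reach1 k P Q : std_step P Q -> #|Q| <= k -> std_reach k P Q.
Proof. by move=> PQ Qk; exists [:: Q]; rewrite /= ?PQ ?Qk ?eqxx. Qed.

Lemma std_reach_sub k P Q : Q \subset P -> #|P| <= k -> std_reach k P Q.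
Proof.
have [m] := ubnP #|P|; elim: m P => // m IHm P; rewrite ltnS => Pm QP Pk.
have [->|] := eqVneq P Q; first exact: std_reach_refl.
rewrite eqEsubset QP andbT => /subsetPn[v vP vQ].
have cP : #|P :\ v| < #|P| by rewrite [ltnRHS](cardsD1 v) vP.
apply: (@std_reach_trans _ _ (P :\ v)); last apply: IHm; try lia.
  apply: std_reach1; last lia.
  by apply/orP; right; apply/existsP; exists v; rewrite vP eqxx.
by rewrite subsetD1 QP.
Qed.

Definition window v : {set helix} := [set u : helix | u <= v < u + w].

Lemma card_window v : #|window v| <= w.
Proof.
rewrite -[leqRHS]card_ord.
apply: (@leq_card_in _ _ (fun u : helix => inord (v - u) : 'I_w)) => //.
move=> u u'; rewrite !inE => vu vu' /(congr1 val) /=.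
rewrite !inordK; try lia; move=> e; apply: val_inj => /=; lia.
Qed.

(** Both predecessors of the next vertex, one step and [w] steps back, lie in the current window, so
    one extra pebble suffices to advance before the lowest one is dropped. *)
Lemma std_reach_window v : std_reach w.+1 set0 (window v).
Proof.
case: v => m mN; elim: m mN => [|m IHm] mN.
  have -> : window (Ordinal mN) = Ordinal mN |: set0.
    by apply/setP => u; rewrite !inE orbF -val_eqE /=; lia.
  apply: std_reach1; last by rewrite setU0 cards1.
  apply/orP; left; apply/existsP; exists (Ordinal mN); rewrite inE eqxx andbT.
  by apply/subsetP => u; rewrite !inE helix_edgeE /=; lia.
have mN' : m < N.+1 by lia.
apply: (std_reach_trans (IHm mN')).
apply: (@std_reach_trans _ _ (Ordinal mN |: window (Ordinal mN'))).
  apply: std_reach1.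
    apply/orP; left; apply/existsP; exists (Ordinal mN); rewrite eqxx andbT.
    apply/andP; split; first by rewrite inE /=; lia.
    by apply/subsetP => u; rewrite !inE helix_edgeE /=; lia.
  by rewrite cardsU1; have := card_window (Ordinal mN'); case: (_ \notin _); lia.
apply: std_reach_sub.
  by apply/subsetP => u; rewrite !inE -val_eqE /=; lia.
by rewrite cardsU1; have := card_window (Ordinal mN'); case: (_ \notin _); lia.
Qed.

Lemma helix_std_price : std_price (ord_max : helix) <= w.+1.
Proof.
have : std_reach w.+1 set0 [set ord_max : helix].
  apply: std_reach_trans (std_reach_window ord_max) _.
  apply: std_reach_sub; last by have := card_window ord_max; lia.
  by apply/subsetP => u; rewrite !inE => /eqP -> /=; lia.
case=> Ps /andP[pPs /eqP lPs] aPs; rewrite /std_price; case: ex_minnP => k _ kmin.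
apply: (@leq_trans (space Ps)).
  by apply: kmin; apply/asboolP; exists Ps.
rewrite /space big_cons cards0 max0n; apply/bigmax_leqP_seq => P PPs _.
exact: (allP aPs).
Qed.

(** * Pebble-free paths in a fixed configuration *)

Definition free P (p : seq helix) := all (fun v => v \notin P) p.

Definition link a u P := exists x p,
  [/\ a <= x < a + w, path (@edge helix) x p, last x p = u & free P (x :: p)].

Lemma link_cat a v P p : link a v P -> path (@edge helix) v p -> free P p ->
  link a (last v p) P.
Proof.
case=> x [q [ax xq <- fq]] vp fp; exists x, (q ++ p).
by split; rewrite ?cat_path ?xq ?last_cat // /free -cat_cons all_cat -!/(free _ _) fq.
Qed.

Lemma link_edge a u v P : link a u P -> edge u v -> v \notin P -> link a v P.
Proof.
by move=> lu uv vP; apply: (@link_cat _ _ _ [:: v] lu); apply/andP.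
Qed.

Lemma link_free a u P : link a u P -> u \notin P.
Proof. by case=> x [p [_ _ <- /allP]]; apply; exact: mem_last. Qed.

(* Edges advance by at most [w], so no path jumps over [w] consecutive
   vertices. *)
Lemma path_hits x p c : path (@edge helix) x p -> x < c + w -> c <= last x p ->
  exists p1 p2, p = p1 ++ p2 /\ c <= last x p1 < c + w.
Proof.
elim: p x => [|y p IHp] x /= => [_ xc cx|/andP[xy yp] xc cl].
  by exists [::], [::]; rewrite /= cx xc.
have [cx|xc'] := leqP c x; first by exists [::], (y :: p); rewrite /= cx xc.
have := helix_edge_lt xy; move=> xy'.
have [|p1 [p2 [-> h]]] := IHp _ yp _ cl; first lia.
by exists (y :: p1), p2.
Qed.

Lemma link_split a u P c : link a u P -> a <= c <= u -> exists y,
  [/\ c <= y < c + w, link a y P, link c u P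
    & exists2 p, path (@edge helix) y p && (last y p == u) & free P (y :: p)].
Proof.
move=> [x [p [ax xp lp fp]]] acu.
have [||p1 [p2 [e h]]] := path_hits (c := c) xp; [lia | by rewrite lp; lia |].
move: xp lp fp; rewrite e cat_path last_cat /free -cat_cons all_cat.
move=> /andP[xp1 yp2] lp /andP[fp1 fp2].
have yP : last x p1 \notin P by apply: (allP fp1); exact: mem_last.
exists (last x p1); split=> //.
- by exists x, p1.
- by exists (last x p1), p2; rewrite /free /= yP.
- by exists p2; rewrite ?yp2 ?lp ?eqxx //= yP.
Qed.

(** * Evolution of free paths over time *)

Definition steps (P : nat -> {set helix}) :=
  forall t, P t = P t.+1 \/ rev_step (P t) (P t.+1).

Lemma steps_shift (P : nat -> {set helix}) s : steps P -> steps (fun t => P (s + t)).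
Proof. by move=> sP t; rewrite addnS; exact: sP. Qed.

(** Truncated subtraction keeps the reversed run at [P 0] from time [s] on; the idle moves in
    [steps] permit this. *)
Lemma steps_rev (P : nat -> {set helix}) s : steps P -> steps (fun t => P (s - t)).
Proof.
move=> sP t; have [ts|st] := ltnP t s; last by left; congr P; lia.
have -> : s - t = (s - t.+1).+1 by lia.
by case: (sP (s - t.+1)) => [->|h]; [left | right; rewrite rev_step_sym].
Qed.

Lemma rev_step_new P Q v : P = Q \/ rev_step P Q -> v \notin P -> v \in Q ->
  preds v \subset P /\ forall u, u \in Q -> u != v -> u \in P.
Proof.
move=> [->|/orP[]]; first by move=> /negPf->.
  move=> /existsP[y /and3P[yP pP /eqP->]] vP; rewrite !inE (negPf vP) orbF.
  move=> /eqP->; split=> // u; rewrite !inE => /orP[/eqP->|//].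
  by rewrite eqxx.
by move=> /existsP[y /and3P[yP pP /eqP->]] /negPf vP; rewrite !inE vP andbF.
Qed.

(** A vertex gets a pebble only when all its predecessors carry one, and every vertex of a free path
    after the first has an unpebbled predecessor on that path. *)
Lemma free_step P Q x p : P = Q \/ rev_step P Q -> path (@edge helix) x p ->
  free P (x :: p) -> x \notin Q -> free Q (x :: p).
Proof.
rewrite /free => PQ; elim: p x => [|y p IHp] x /=; first by rewrite !andbT.
move=> /andP[xy yp] /andP[xP yfP] xQ; rewrite xQ; apply: IHp => //.
have yP : y \notin P by case/andP: yfP.
apply/negP => yQ; have [/subsetP/(_ x)] := rev_step_new PQ yP yQ.
by rewrite inE (negPf xP) => /(_ xy).
Qed.

Lemma free_persists (P : nat -> {set helix}) x p j : steps P -> path (@edge helix) x p ->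
  free (P 0) (x :: p) -> (forall i, i <= j -> x \notin P i) -> free (P j) (x :: p).
Proof.
move=> sP xp f0; elim: j => // j IHj xj.
apply: free_step (sP j) xp _ (xj _ _) => //.
by apply: IHj => i ij; apply: xj; lia.
Qed.

Lemma first_reached (P : nat -> {set helix}) x p j : steps P -> path (@edge helix) x p ->
  free (P 0) (x :: p) -> ~~ free (P j) (x :: p) -> exists2 i, i <= j & x \in P i.
Proof.
move=> sP xp f0 fj; apply: contrapT => h; case/negP: fj.
apply: free_persists => // i ij; apply/negP => xi; apply: h; by exists i.
Qed.

(** * Pebble counts and lightly pebbled intervals *)

Definition peb P a b := #|[set y in P | a <= (y : helix) < b]|.

Lemma peb_le P a b a' b' : a' <= a -> b <= b' -> peb P a b <= peb P a' b'.
Proof.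
move=> aa bb; apply/subset_leq_card/subsetP => y; rewrite !inE => /andP[->] /=.
lia.
Qed.

Lemma peb_split P b a c : a <= b <= c -> peb P a c = peb P a b + peb P b c.
Proof.
move=> abc; rewrite /peb -(cardsID [set y : helix | y < b]); congr (_ + _).
  by apply: eq_card => y; rewrite !inE; case: (y \in P) => //=; lia.
by apply: eq_card => y; rewrite !inE; case: (y \in P) => //=; lia.
Qed.

Lemma pigeonhole (S : {set helix}) (f : helix -> 'I_w) : #|S| < w ->
  exists r, forall y, y \in S -> f y != r.
Proof.
move=> Sw; have [r rS] : exists r, r \notin f @: S.
  apply/existsP; rewrite -negb_forall; apply/negP => /forallP h.
  have: #|'I_w| <= #|f @: S| by apply/subset_leq_card/subsetP => r _; exact: h.
  by rewrite card_ord; have := leq_imset_card f S; lia.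
exists r => y yS; apply: contraNneq rS => <-; exact: imset_f.
Qed.

Local Notation K := (2 * w * w).

(* With fewer than [w] pebbles some residue class modulo [w] is free, and so is
   some block of [2 w] consecutive vertices in [c, c + K[. Climbing the residue
   class up to the block and then walking along it reaches all of its second
   half, which any path crossing the block meets. *)
Lemma light_link P lo c x p : path (@edge helix) x p -> lo <= c -> x < c + w ->
  c + K <= last x p -> peb P lo (c + K) < w ->
  exists p1 p2, [/\ p = p1 ++ p2, c <= last x p1 < c + K & link lo (last x p1) P].
Proof.
move=> xp loc xc cl /[dup]
  /(pigeonhole (fun y : helix => inord (y %% w)))[r hr]
  /(pigeonhole (fun y : helix => inord ((y - c) %/ (2 * w))))[i hi].
have clN : c + K <= N by have := ltn_ord (last x p); lia.
pose e := c + 2 * w * i; have iw := ltn_ord i.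
have eK : e + 2 * w <= c + K.
  rewrite /e -addnA leq_add2l -[X in _ + X]muln1 -mulnDr leq_mul2l; lia.
have free_block y : e <= y < e + 2 * w -> y \notin P.
  move=> ye; apply/negP => yP; have := hi y; rewrite inE yP /=.
  have -> : lo <= y < c + K by lia.
  move=> /(_ isT) /eqP; apply; apply: val_inj => /=.
  have yi : (y - c) %/ (2 * w) = i.
    have -> : y - c = i * (2 * w) + (y - e) by lia.
    rewrite divnMDl; last lia.
    by rewrite divn_small ?addn0 //; lia.
  by rewrite inordK yi.
have column y : y %% w = r -> lo <= y < c + K -> link lo y P.
  have free_col v : v %% w = r -> lo <= v < c + K -> v \notin P.
    move=> vr lov; apply/negP => vP; have := hr v; rewrite inE vP lov.
    by move=> /(_ isT) /eqP; apply; apply: val_inj; rewrite /= inordK vr.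
  have [m] := ubnP (y : nat); elim: m y => // m IHm y my yr loy.
  have [ylo|ylo] := ltnP y (lo + w).
    exists y, [::]; split=> //; first lia.
    by rewrite /free /= free_col.
  have yN := ltn_ord y.
  have zE : (inord (y - w) : helix) = y - w :> nat by rewrite inordK; lia.
  apply: (@link_edge _ (inord (y - w) : helix)); last exact: free_col.
    apply: IHm; rewrite ?zE; try lia.
    by rewrite -yr -{2}(@subnK w y) ?modnDr //; lia.
  by rewrite helix_edgeE zE; apply/orP; right; apply/eqP; lia.
have [m em mr] : exists2 m, e <= m < e + w & m %% w = r.
  have := ltn_pmod e (ltn0Sn w0); have := ltn_ord r => rw ew.
  have [h|h] := leqP (e %% w) r.
    exists (e + (r - e %% w)); first lia.
    rewrite {1}(divn_eq e w) -addnA subnKC // modnMDl modn_small //.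
  exists (e + (r + w - e %% w)); first lia.
  have -> : e + (r + w - e %% w) = (e %/ w).+1 * w + r.
    by rewrite {1}(divn_eq e w) mulSn; lia.
  by rewrite modnMDl modn_small.
have row k y : y = m + k :> nat -> y < e + 2 * w -> link lo y P.
  elim: k y => [|k IHk] y yE ye.
    by apply: column; rewrite yE ?addn0 //; lia.
  have yN := ltn_ord y.
  have zE : (inord (m + k) : helix) = m + k :> nat by rewrite inordK; lia.
  apply: (@link_edge _ (inord (m + k) : helix)).
  - by apply: IHk; rewrite zE //; lia.
  - by rewrite helix_edgeE zE; apply/orP; left; apply/eqP; lia.
  - by apply: free_block; lia.
have [||p1 [p2 [-> h]]] := path_hits (c := e + w) xp; try lia.
exists p1, p2; split=> //; first lia.
by apply: (row (last x p1 - m)); lia.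
Qed.

(** At the light time [s] the path meets a vertex [v] linked to [lo], hence also to [a1]. If the
    rest of the path were free, its end would be linked to [a1] again; so it is blocked, and [v]
    must have been pebbled at some [s']. This is neither [0] nor [s], since [v] is free at both
    times. *)
Lemma relink (P : nat -> {set helix}) a1 x p j s lo c :
    steps P -> path (@edge helix) x p -> free (P 0) (x :: p) -> a1 <= x < a1 + w ->
    (forall t, 0 < t <= j -> ~ link a1 (last x p) (P t)) ->
    0 < s <= j -> lo <= a1 <= c -> c + K <= last x p ->
    peb (P s) lo (c + K) < w ->
  exists v s', [/\ c <= v < c + K, 0 < s' < s, v \in P s' & link lo v (P s)].
Proof.
move=> sP xp f0 ax unl sj loc cl light.
have [||p1 [p2 [e vc lov]]] := light_link xp _ _ cl light; try lia.
exists (last x p1).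
have: path (@edge helix) (last x p1) p2 by move: xp; rewrite e cat_path => /andP[].
have: free (P 0) (last x p1 :: p2).
  apply/allP => y yp2; apply: (allP f0); rewrite e -cat_cons mem_cat.
  by move: yp2; rewrite inE => /orP[/eqP->|->]; rewrite ?mem_last ?orbT.
move=> fv vp2; have vs := link_free lov.
have [y [_ _ l1 _]] := link_split (c := a1) lov ltac:(lia).
have [|i ij vi] := first_reached (j := s) sP vp2 fv.
  apply/negP => /andP[_ fs]; apply: (unl s sj).
  by rewrite e last_cat; exact: link_cat l1 vp2 fs.
exists i; split=> //; have [i0|] := posnP i.
  by move: vi; rewrite i0; case/andP: fv => /negPf->.
by move: ij; rewrite leq_eqVlt => /orP[/eqP is_|//]; rewrite -is_ vi in vs.
Qed.

(** * Induction on the number of levels *)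

Fixpoint reach_bound k := if k is k'.+1 then 2 * reach_bound k' + w + 2 * K else K.
Local Notation f := reach_bound.

Lemma last_time (Q : nat -> Prop) j : Q 0 -> ~ Q j ->
  exists2 t, t < j /\ Q t & forall i, t < i <= j -> ~ Q i.
Proof.
elim: j => [//|j IHj] Q0 Qj; have [Qj'|nQj] := pselect (Q j).
  exists j => // i ij; have -> : i = j.+1 by lia.
  by [].
have [t [tj Qt] h] := IHj Q0 nQj; exists t => [|i ti]; first by split=> //; lia.
have [->//|ij] := eqVneq i j.+1; apply: h; lia.
Qed.

(** The run may start in any configuration, so the claim applies to shifted and reversed runs.
    Counting only pebbles from [a] to [u] lets the counts of disjoint intervals be added. *)
Definition forces k := forall (P : nat -> {set helix}) a u j,
  steps P -> link a u (P 0) -> u \in P j -> a + f k <= u -> exists2 l, l <= j & k.+1 * w <= peb (P l) a u.+1.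

(* [0] is the last time at which [u] is linked to [a1]. The first later time at
   which the part below [a2] or the part above [a1] holds fewer than [w] pebbles
   would be preceded by a time at which the part below [a1], resp. above [a2],
   holds [k.+1 * w] pebbles, whence the other part was light even earlier. *)
Lemma forcesS_critical k (P : nat -> {set helix}) a u j : forces k -> steps P ->
    link (a + f k + w) u (P 0) ->
    (forall t, 0 < t <= j -> ~ link (a + f k + w) u (P t)) ->
    u \in P j -> a + f k.+1 <= u ->
  exists2 l, l <= j & k.+2 * w <= peb (P l) a u.+1.
Proof.
set a1 := a + f k + w; pose a2 := a1 + K => IH sP l0 unl uj au.
have fS : f k.+1 = 2 * f k + w + 2 * K by [].
apply: contrapT => nheavy.
have total l : l <= j -> peb (P l) a u.+1 < k.+2 * w.
  by move=> lj; rewrite ltnNge; apply/negP => h; apply: nheavy; exists l.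
have j0 : 0 < j.
  rewrite lt0n; apply/eqP => j0; move: uj; rewrite j0.
  by rewrite (negPf (link_free l0)).
have split1 l := @peb_split (P l) a1 a u.+1 ltac:(lia).
have split2 l := @peb_split (P l) a2 a u.+1 ltac:(lia).
case: (l0) => x [p [ax xp lp f0]].
have no_light s : 0 < s <= j -> w <= peb (P s) a a2 /\ w <= peb (P s) a1 u.+1.
  elim/ltn_ind: s => s IHs sj; split; rewrite leqNgt; apply/negP => light.
    have [|||v [s' [va s's vs' lv]]] :=
      relink (lo := a) (c := a1) sP xp f0 ax _ sj _ _ light;
      rewrite ?lp //; try lia.
    (* Passing from [v] down to [r] keeps the counted pebbles below [a1]. Backwards from [s], the
       free path from [r] to [v] is blocked by time [s'], so [r] is pebbled in between and the
       induction hypothesis applies to the reversed run. *)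
    have [r [ra lr _ [q /andP[rq /eqP lq] fq]]] :=
      link_split (c := a1 - w) lv ltac:(lia).
    have sR := steps_rev s sP.
    have [||i ij ri] := first_reached (j := s - s') sR rq.
    - by rewrite subn0.
    - have -> : s - (s - s') = s' by lia.
      by apply/negP => /allP/(_ v); rewrite -lq mem_last lq vs' => /(_ isT).
    have [||l li hl] := IH _ a r i sR _ ri; [by rewrite subn0 | lia |].
    have hl' := leq_trans hl (peb_le (P (s - l)) (leqnn a) (_ : r.+1 <= a1)).
    have {}hl' := hl' ltac:(lia).
    have [ls|ls] := ltnP (s - l) s.
      have [|_] := IHs _ ls; first lia.
      have := total (s - l) ltac:(lia); rewrite split1; lia.
    have sE : s - l = s by lia.
    have := peb_le (P s) (leqnn a) (_ : a1 <= a2); rewrite sE in hl'.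
    by move=> /(_ ltac:(lia)); lia.
  (* Here [v] lies in the top zone, at least [f k] above [a2], so the induction hypothesis applies
     to [v] itself. *)
  have lightK : peb (P s) a1 (u - K + K) < w.
    by apply: leq_ltn_trans light; apply: peb_le; lia.
  have [|||v [s' [va s's vs' lv]]] :=
    relink (lo := a1) (c := u - K) sP xp f0 ax _ sj _ _ lightK;
    rewrite ?lp //; try lia.
  have [_ [_ _ lv2 _]] := link_split (c := a2) lv ltac:(lia).
  have sR := steps_rev s sP.
  have [|||l li hl] := IH _ a2 v (s - s') sR; [by rewrite subn0 | | lia |].
    by have -> : s - (s - s') = s' by lia.
  have hl' := leq_trans hl (peb_le (P (s - l)) (leqnn a2) (_ : v.+1 <= u.+1)).
  have {}hl' := hl' ltac:(lia).
  have [ls|ls] := ltnP (s - l) s.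
    have [|+ _] := IHs _ ls; first lia.
    have := total (s - l) ltac:(lia); rewrite split2; lia.
  have sE : s - l = s by lia.
  have := peb_le (P s) (_ : a1 <= a2) (leqnn u.+1); rewrite sE in hl'.
  by move=> /(_ ltac:(lia)); lia.
(* Only a pebble on [x] can unlink [u] from [a1] at time [1]. The move changes no other vertex, so
   the path stays free from [y] on, which lies above [x]. *)
have link1 : link a2 u (P 1).
  have [y [ya _ _ [q /andP[yq /eqP lq] fq]]] :=
    link_split (c := a2) l0 ltac:(lia).
  exists y, q; split=> //; apply: (free_step (sP 0) yq fq).
  have x1 : x \in P 1.
    apply: contrapT => /negP x1; apply: (unl 1); first lia.
    by exists x, p; split=> //; exact: free_step (sP 0) xp f0 x1.
  have x0 : x \notin P 0 by case/andP: f0.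
  have yx : y != x by rewrite -val_eqE /=; lia.
  apply/negP => y1; have [_ /(_ y y1 yx)] := rev_step_new (sP 0) x0 x1.
  by case/andP: fq => /negPf->.
have [|||l lj hl] := IH _ a2 u j.-1 (steps_shift 1 sP).
- by [].
- by rewrite /= add1n prednK.
- lia.
have [|h _] := no_light (1 + l); first lia.
have := total (1 + l) ltac:(lia); rewrite split2; lia.
Qed.

(** Time is restarted at the last moment at which [u] is linked to the relevant point: [a] in the
    base case, [a + f k + w] in the step. *)
Lemma helix_forces k : forces k.
Proof.
elim: k => [|k IHk] P a u j sP l0 uj au.
  have [|t [tj lt] h] := last_time (Q := fun t => link a u (P t)) (j := j) l0.
    by move=> /link_free; rewrite uj.
  exists t.+1 => //; rewrite mul1n leqNgt; apply/negP => light.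
  case: lt => x [p [ax xp lp ft]].
  have light' : peb (P (t + 1)) a (u - K + K) < w.
    by rewrite addn1; apply: leq_ltn_trans light; apply: peb_le; rewrite /= in au; lia.
  rewrite /= in au.
  (* A light configuration right after that moment would yield a time [s'] with [0 < s' < 1]. *)
  have [|||||v [s' []]] := relink (P := fun i => P (t + i)) (a1 := a) (j := 1)
    (s := 1) (c := u - K) (steps_shift t sP) xp _ ax _ _ _ _ light'; try lia.
  - by rewrite addn0.
  - move=> i i1; rewrite lp; apply: h; lia.
  - by rewrite lp; lia.
have fS : f k.+1 = 2 * f k + w + 2 * K by [].
have [_ [_ _ l1 _]] := link_split (c := a + f k + w) l0 ltac:(lia).
have [|t [tj lt] h] :=
  last_time (Q := fun t => link (a + f k + w) u (P t)) (j := j) l1.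
  by move=> /link_free; rewrite uj.
have [|||l lj hl] := forcesS_critical (j := j - t) IHk (steps_shift t sP) _ _ _ au.
- by rewrite addn0.
- by move=> i it; apply: h; lia.
- by rewrite subnKC //; lia.
by exists (t + l) => //; lia.
Qed.

(** The summand [5 * w * w] makes the induction close: as [2 * K = 4 * w * w], one has
    [w + 2 * K + 5 * w * w <= 2 * (5 * w * w)]. *)
Lemma reach_boundE k : f k + 5 * w * w <= 8 * w * w * 2 ^ k.
Proof.
elim: k => [|k IHk]; first by rewrite /= expn0; lia.
have -> : f k.+1 = 2 * f k + w + 2 * K by [].
rewrite expnS; have : w <= w * w by rewrite leq_pmull.
lia.
Qed.

Lemma helix_rev_price k : 8 * w * w * 2 ^ k <= N ->
  k.+1 * w <= rev_price (ord_max : helix).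
Proof.
move=> kN; rewrite /rev_price; case: ex_minnP => m /asboolP[Ps [pPs lPs] <-] _.
(* The default value is the final configuration, so the pebbling idles there forever. *)
pose P t := nth [set ord_max] (set0 :: Ps) t.
have sP : steps P.
  move=> t; have [tP|Pt] := ltnP t (size Ps).
    by right; rewrite /P /=; exact: (pathP _ pPs).
  left; rewrite /P [in RHS]nth_default //.
  move: Pt; rewrite leq_eqVlt => /orP[/eqP <-|Pt]; last by rewrite nth_default.
  by rewrite -last_nth.
have link0 : link 0 (ord_max : helix) (P 0).
  have: forall i y, y = i :> nat -> link 0 y (P 0).
    elim=> [|i IHi] y yi.
      by exists y, [::]; rewrite /free /= inE yi.
    have yN := ltn_ord y.
    have zE : (inord i : helix) = i :> nat by rewrite inordK; lia.
    apply: (link_edge (IHi _ zE)); rewrite ?inE // helix_edgeE zE yi eqxx //.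
  by move=> h; exact: (h N).
have [||l lP hl] := helix_forces (k := k) (j := size Ps) sP link0.
- by rewrite /P -last_nth lPs inE.
- by have := reach_boundE k; rewrite /=; lia.
apply: (leq_trans hl); apply: (@leq_trans #|P l|).
  by apply/subset_leq_card/subsetP => y; rewrite inE => /andP[].
rewrite /space; apply: (@leq_bigmax_seq _ (set0 :: Ps) xpredT (fun P => #|P|)) => //.
by rewrite mem_nth.
Qed.

End Helix.

(* Choice of parameters and asymptotics *)
From mathcomp Require Import all_order all_algebra.
From mathcomp Require Import all_classical all_reals all_analysis.
From mathcomp Require Import lra.

Import Order.TTheory GRing.Theory Num.Theory.
Import numFieldNormedType.Exports.

Local Open Scope classical_set_scope.
Local Open Scope ring_scope.

Lemma log2_bracket (m n : nat) : (0 < m <= n)%N ->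
  exists k, (m * 2 ^ k <= n < m * 2 ^ k.+1)%N.
Proof.
move=> /andP[m0 mn]; have q0 : (0 < n %/ m)%N by rewrite divn_gt0.
have /andP[kq qk] := trunc_log_bounds (isT : (1 < 2)%N) q0.
exists (trunc_log 2 (n %/ m)).
rewrite mulnC -leq_divRL // kq /= (leq_trans (ltn_ceil n m0)) //.
by rewrite mulnC leq_mul2l qk orbT.
Qed.

Theorem theorem3p1 (R : realType) :
  exists a b c : R, [/\ 0 < a, 0 < b, 0 < c &
    forall d : R, 0 < d -> exists2 C : R, 0 < C &
    forall (eps : R) (s : nat -> R),
      0 < eps ->
      (\forall n \near \oo, d <= s n) ->
      s =O_\oo (fun n : nat => (n%:R : R) `^ (2^-1 - eps)) ->
      exists (G : nat -> dag) (z : forall n : nat, G n),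
        (forall n : nat, (0 < n)%N ->
           unique_sink (z n) /\ fan_in_le (G n) 2) /\
        \forall n \near \oo,
          [/\ a * n%:R <= #|G n|%:R <= b * n%:R,
              (std_price (z n))%:R <= C * s n &
              c * eps * s n * ln n%:R <= (rev_price (z n))%:R]].
Proof.
(* There are [n + 1] vertices, between [n] and [2 n]. Since [d <= s n], the standard price is at
   most [w + 1 <= s n + 2 <= (1 + 2 / d) * s n]. The last [1] comes from [ln 2 <= 1]. *)
exists 1, 2, 1; split=> // d d0; exists (1 + 2 / d) => [|eps s eps0 sd sO].
  by rewrite addr_gt0 ?divr_gt0.
pose w0 n := Num.truncn (s n).
exists (fun n => helix n (w0 n)), (fun n => ord_max).
split=> [n _|]; first by split; [exact: helix_sink | exact: helix_fan_in].
have /eqO_exP [M0 M00 sM0] := sO.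
have d1 : 0 < 1 + 1 / d by rewrite addr_gt0 ?divr_gt0.
pose M := (1 + 1 / d) * M0; have M_gt0 : 0 < M by rewrite mulr_gt0.
pose L := ln (8 * M ^+ 2).
near=> n.
have n0 : (0 < n)%N by near: n; exact: nbhs_infty_gt.
have nR0 : 0 < n%:R :> R by rewrite ltr0n.
have sdn : d <= s n by near: n.
have s0 : 0 < s n by exact: lt_le_trans sdn.
have sM : s n <= M0 * n%:R `^ (2^-1 - eps).
  have : `|s n| <= M0 * `|(n%:R : R) `^ (2^-1 - eps)| by near: n.
  by rewrite !ger0_norm ?powR_ge0 // ltW.
(* Of the factor [n ^ (2 eps)] by which [n] exceeds [w ^ 2], one [n ^ eps] absorbs the constant
   [8 * M ^ 2]; the other bounds [k] from below. *)
have Ln : L <= eps * ln n%:R.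
  rewrite mulrC -ler_pdivrMr // -(expRK (L / eps)) ler_ln ?posrE ?expR_gt0 //.
  by near: n; exact: nbhs_infty_ger.
have wP := truncn_itv (ltW s0); rewrite -/(w0 n) in wP.
pose w := (w0 n).+1.
have wE : w%:R = (w0 n)%:R + 1 :> R by rewrite /w -natr1.
have sdiv : 1 <= s n / d by rewrite ler_pdivlMr // mul1r.
have ws : w%:R <= (1 + 1 / d) * s n.
  rewrite wE mulrDl !mul1r [d^-1 * _]mulrC; case/andP: wP; lra.
have wM : w%:R <= M * n%:R `^ (2^-1 - eps).
  by rewrite (le_trans ws) // /M -mulrA ler_wpM2l // ltW.
have lnw : ln (8 * w * w)%N%:R <= L + (1 - 2 * eps) * ln n%:R :> R.
  rewrite mulrBl mul1r.
  have -> : ln n%:R - 2 * eps * ln n%:R = (1 - 2 * eps) * ln n%:R :> R by lra.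
  rewrite -ln_powR /L -lnM ?posrE ?powR_gt0 ?mulr_gt0 ?exprn_gt0 //.
  rewrite ler_ln ?posrE ?ltr0n ?mulr_gt0 ?powR_gt0 ?exprn_gt0 //.
  have -> : 1 - 2 * eps = (2^-1 - eps) + (2^-1 - eps) by lra.
  rewrite powRD; last by rewrite (gt_eqF nR0) implybT.
  rewrite !natrM expr2 -[leLHS]mulrA -[leRHS]mulrA mulrACA ler_wpM2l //.
  by apply: ler_pM => //; exact: ler0n.
have epsln : 0 <= eps * ln n%:R by rewrite mulr_ge0 ?ln_ge0 ?ler1n // ltW.
have wn : (8 * w * w <= n)%N.
  rewrite -(ler_nat R) -ler_ln ?posrE ?ltr0n //; lra.
have [//|k /andP[kn nk]] := @log2_bracket (8 * w * w)%N n.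
have ln2 : ln 2 <= 1 :> R by have := @le_ln1Dx R 1; rewrite -[1 + 1]/2%R; apply; lra.
have kln : eps * ln n%:R <= k.+1%:R.
  have : ln n%:R <= ln (8 * w * w * 2 ^ k.+1)%N%:R :> R.
    by rewrite ler_ln ?posrE ?ltr0n ?muln_gt0 ?expn_gt0 // ler_nat ltnW.
  rewrite natrM natrX lnM ?posrE ?ltr0n ?exprn_gt0 // lnXn // -[ln 2 *+ _]mulr_natr => h.
  have : ln 2 * k.+1%:R <= k.+1%:R :> R by rewrite ler_piMl.
  lra.
split.
- rewrite card_ord -natr1 mul1r mulr_natl mulr2n lerDl ler01 lerD2l.
  by rewrite -[1]/(1%:R) ler_nat.
- apply: (@le_trans _ _ (w.+1)%:R); first by rewrite ler_nat; exact: helix_std_price.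
  rewrite -natr1 wE mulrDl mul1r mulrAC -mulrA; case/andP: wP; lra.
- apply: (@le_trans _ _ (k.+1 * w)%N%:R); last first.
    by rewrite ler_nat; exact: helix_rev_price.
  rewrite mul1r mulrAC natrM; apply: ler_pM => //; last by rewrite ltW //; case/andP: wP.
  - exact: ltW.
Unshelve. all: by end_near.
Qed.
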